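(* Let $M=(ST,AC,out_{AG},L)$ be a grand-coalition-first action model with determined outcome functions $\{out_C\}_{C\subseteq AG}$, and let $s\in ST$. The following three conditions are equivalent: (1) for all $a\in AG$ and $\sigma_a,\sigma'_a\in JA_{\{a\}}$, if $\sigma_a\neq\sigma'_a$ then $out_{\{a\}}(s,\sigma_a)\cap out_{\{a\}}(s,\sigma'_a)=\emptyset$; (2) for all $C\subseteq AG$ and $\sigma_C,\sigma'_C\in JA_C$, if $\sigma_C\neq\sigma'_C$ then $out_C(s,\sigma_C)\cap out_C(s,\sigma'_C)=\emptyset$; (3) for all $\sigma_{AG},\sigma'_{AG}\in JA_{AG}$, if $\sigma_{AG}\neq\sigma'_{AG}$ then $out_{AG}(s,\sigma_{AG})\cap out_{AG}(s,\sigma'_{AG})=\emptyset$.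
   Context: $AG$ is a finite nonempty set of agents, $AP$ a countable set of atomic propositions. For a nonempty set $AC$ and $C\subseteq AG$, $JA_C$ is the set of functions $\sigma_C:C\to AC$ ($JA_\emptyset=\{\emptyset\}$); $\sigma_C\subseteq\sigma_{AG}$ means $\sigma_C$ is the restriction of $\sigma_{AG}$ to $C$. A grand-coalition-first action model is $(ST,AC,out_{AG},L)$ with $ST,AC$ nonempty sets, $out_{AG}:ST\times JA_{AG}\to\mathcal P(ST)$, $L:ST\to\mathcal P(AP)$; its determined outcome functions are $out_C(s,\sigma_C)=\bigcup\{out_{AG}(s,\sigma_{AG})\mid\sigma_{AG}\in JA_{AG},\sigma_C\subseteq\sigma_{AG}\}$. *)

(* Defs.v *)
From mathcomp Require Import all_boot.
From mathcomp Require Import boolp classical_sets.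

Set Implicit Arguments.
Unset Strict Implicit.
Unset Printing Implicit Defensive.

Definition joint_action (AG : finType) (AC : Type) (C : {set AG}) : Type :=
  {a : AG | a \in C} -> AC.

(* [sigma_C] is the restriction of [sigma_D] to [C] (meant for [C \subset D]). *)
Definition restriction_of (AG : finType) (AC : Type) (C D : {set AG})
    (sigma_C : joint_action AC C) (sigma_D : joint_action AC D) : Prop :=
  forall (a : AG) (aC : a \in C) (aD : a \in D),
    sigma_C (exist _ a aC) = sigma_D (exist _ a aD).

Record gcf_action_model (AG : finType) (AP : countType) := GCFActionModel {
  ST : Type;
  AC : Type;
  ST_nonempty : inhabited ST;
  AC_nonempty : inhabited AC;
  out_AG : ST -> joint_action AC [set: AG] -> set ST;
  label : ST -> set AP
}.

Definition JA (AG : finType) (AP : countType) (M : gcf_action_model AG AP)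
    (C : {set AG}) : Type :=
  joint_action (AC M) C.

Local Open Scope classical_set_scope.

Definition out (AG : finType) (AP : countType) (M : gcf_action_model AG AP)
    (C : {set AG}) (s : ST M) (sigma_C : JA M C) : set (ST M) :=
  \bigcup_(sigma in [set sigma : JA M [set: AG]%SET
                       | restriction_of sigma_C sigma]) out_AG s sigma.

(* Main.v *)
Require Import Defs.
From mathcomp Require Import all_boot.
From mathcomp Require Import boolp classical_sets.

Local Open Scope classical_set_scope.

(** Disjointness for distinct actions says that an outcome state determines the action
    ([disjoint_neqP]). Condition (2) contains (1) as the case of singletons. From (1) to (3): a
    common outcome of two grand actions is an outcome of their restrictions to each single agent
    ([out_AG_sub_out]), so these agree, and individual choices determine a grand action
    ([grand_eqP]). From (3) to (2): a common outcome of two actions of [C] comes from grand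
    extensions of each; these coincide, and a grand action has only one restriction to [C]
    ([restriction_of_inj]). *)

Definition restrict {AG : finType} {AC : Type} (C : {set AG})
    (sigma : joint_action AC [set: AG]%SET) : joint_action AC C :=
  fun i => sigma (exist _ (sval i) (finset.in_setT (sval i))).

Lemma restrictP {AG : finType} {AC : Type} (C : {set AG})
    (sigma : joint_action AC [set: AG]%SET) :
  restriction_of (restrict C sigma) sigma.
Proof.
by move=> a aC aT; rewrite /restrict /=; congr (sigma (exist _ a _));
  exact: bool_irrelevance.
Qed.

(** [restriction_of] constrains only agents in both coalitions; the inclusion makes it fix every
    value of the smaller action. *)
Lemma restriction_of_inj {AG : finType} {AC : Type} {C D : {set AG}}
    (CD : C \subset D) (sigma sigma' : joint_action AC C)
    (tau : joint_action AC D) :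
  restriction_of sigma tau -> restriction_of sigma' tau -> sigma = sigma'.
Proof.
move=> r r'; apply: funext => -[a aC].
by rewrite (r a aC (fintype.subsetP CD a aC)) (r' a aC (fintype.subsetP CD a aC)).
Qed.

Lemma grand_eqP {AG : finType} {AC : Type}
    (sigma sigma' : joint_action AC [set: AG]%SET) :
  (forall a, restrict [set a]%SET sigma = restrict [set a]%SET sigma') ->
  sigma = sigma'.
Proof.
move=> eq1; apply: funext => -[a aT].
have := congr1 (fun f => f (exist _ a (finset.set11 a))) (eq1 a).
(* [restrictP] exchanges the membership proof built into [restrict] for the given [aT]. *)
by rewrite !(restrictP _ _ a (finset.set11 a) aT).
Qed.

Lemma out_AG_sub_out {AG : finType} {AP : countType}
    (M : gcf_action_model AG AP) (C : {set AG}) (s : ST M)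
    (sigma : JA M [set: AG]%SET) :
  out_AG s sigma `<=` out s (restrict C sigma : JA M C).
Proof. by move=> x xs; exists sigma => //; exact: restrictP. Qed.

(** Contraposition, classical from left to right since equality on [I] need not be decidable. *)
Lemma disjoint_neqP {T I : Type} (F : I -> set T) :
  (forall i j, i <> j -> F i `&` F j = set0) <->
  (forall i j x, F i x -> F j x -> i = j).
Proof.
split=> [dF i j x Fi Fj|injF i j neq].
  by apply: contrapT => /dF F0; have : (F i `&` F j) x by []; rewrite F0.
by rewrite -subset0 => x [Fi Fj]; apply: neq; exact: injF Fi Fj.
Qed.

Theorem theorem5p2 (AG : finType) (AG_nonempty : (0 < #|AG|)%N)
    (AP : countType) (M : gcf_action_model AG AP) (s : ST M) :
  let cond1 := forall (a : AG) (sigma sigma' : JA M [set a]%SET),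
    sigma <> sigma' -> out s sigma `&` out s sigma' = set0 in
  let cond2 := forall (C : {set AG}) (sigma sigma' : JA M C),
    sigma <> sigma' -> out s sigma `&` out s sigma' = set0 in
  let cond3 := forall (sigma sigma' : JA M [set: AG]%SET),
    sigma <> sigma' -> out_AG s sigma `&` out_AG s sigma' = set0 in
  (cond1 <-> cond2) /\ (cond2 <-> cond3).
Proof.
move=> cond1 cond2 cond3.
have c21 : cond2 -> cond1 by move=> c2 a; exact: c2.
have c13 : cond1 -> cond3.
  move=> c1; apply/disjoint_neqP => sigma sigma' x xs xs'.
  apply: grand_eqP => a; have /disjoint_neqP inj1 := c1 a.
  by apply: inj1; apply: out_AG_sub_out; [exact: xs|exact: xs'].
have c32 : cond3 -> cond2.
  move=> /disjoint_neqP inj3 C; apply/disjoint_neqP => sigma sigma' x.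
  move=> [tau r xs] [tau' r' xs'].
  (* The grand extensions [tau] and [tau'] share the outcome [x], so (3) identifies them. *)
  rewrite -(inj3 _ _ _ xs xs') in r'.
  exact: restriction_of_inj (finset.subsetT C) _ _ _ r r'.
by split; split; auto.
Qed.
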